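(* Let $1 \le \alpha < 2$, let $n \ge 1$, let $\beta \in \mathbb{C}$ be a fixed constant, and let $\underline{a_{ij}} \le \overline{a_{ij}}$ ($1 \le i,j \le n$) be real numbers. Let $\mathcal{A}^I$ be the set of real $n\times n$ matrices $[a_{ij}]$ with $a_{ij} \in [\underline{a_{ij}}, \overline{a_{ij}}]$ for all $i,j$, and let $\mathcal{A}^v \subset \mathcal{A}^I$ be the finite set of those with $a_{ij} \in \{\underline{a_{ij}}, \overline{a_{ij}}\}$ for all $i,j$. If there exists a common Hermitian positive-definite matrix $P = P^\ast > 0$ in $\mathbb{C}^{n\times n}$ such that $$\overline{\lambda}\left(\beta P A + \beta^\ast A^T P\right) < 0 \quad \text{for all } A \in \mathcal{A}^v,$$ where $\overline{\lambda}(H)$ denotes the maximum eigenvalue of a Hermitian matrix $H$, then the fractional-order interval system $\frac{\mathrm{d}^\alpha x(t)}{\mathrm{d}t^\alpha} = A x(t)$, $A \in \mathcal{A}^I$, is robust stable.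
   Context: For a complex number, $\beta^\ast$ is the complex conjugate; for a complex matrix, $P^\ast$ is the conjugate transpose. For Hermitian $H$, $H>0$ (resp. $H<0$) means positive (resp. negative) definite. Definition (robust stability). The fractional-order interval system $\frac{\mathrm{d}^\alpha x(t)}{\mathrm{d}t^\alpha} = A x(t)$, $A \in \mathcal{A}^I$, is called robust stable if for every $A \in \mathcal{A}^I$ there exists a Hermitian positive-definite matrix $P_A = P_A^\ast > 0$ in $\mathbb{C}^{n\times n}$ (possibly depending on $A$) such that $\beta P_A A + \beta^\ast A^T P_A < 0$. The definition of robust stability is this matrix-inequality condition; the constant $\beta$ is the same one in the definition and in the vertex condition. *)

(* Defs.v *)
From mathcomp Require Import all_boot all_order all_algebra.
From mathcomp Require Import complex.
From mathcomp Require Import classical_sets reals.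

Set Implicit Arguments.
Unset Strict Implicit.
Unset Printing Implicit Defensive.

Import Order.TTheory GRing.Theory Num.Theory.

Local Open Scope ring_scope.
Local Open Scope sesquilinear_scope.
Local Open Scope classical_set_scope.

(* [0 < z] in the partial order of [R[i]] means that z is real and positive. *)
Definition posdefmx (R : realType) (n : nat) (H : 'M[R[i]]_n) : Prop :=
  H \is hermsymmx /\
  forall v : 'cV[R[i]]_n, v != 0 -> 0 < (v ^t* *m H *m v) 0 0.

Definition negdefmx (R : realType) (n : nat) (H : 'M[R[i]]_n) : Prop :=
  H \is hermsymmx /\
  forall v : 'cV[R[i]]_n, v != 0 -> (v ^t* *m H *m v) 0 0 < 0.

(* Intended for Hermitian H with 0 < n, where the supremum is a maximum over
   the whole spectrum; see [lambda_max_eigenvalue] and [lambda_max_ge]. *)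
Definition lambda_max (R : realType) (n : nat) (H : 'M[R[i]]_n) : R :=
  sup [set x : R | eigenvalue H (x%:C)%C].

(* d^alpha x / dt^alpha = A x with A between [lower] and [upper] entrywise. *)
Record fo_interval_system (R : realType) (n : nat) := FOIntervalSystem {
  order : R;
  lower : 'M[R]_n;
  upper : 'M[R]_n
}.

Definition interval_matrices (R : realType) (n : nat)
    (S : fo_interval_system R n) : set 'M[R]_n :=
  [set A | forall i j, lower S i j <= A i j <= upper S i j].

Definition vertex_matrices (R : realType) (n : nat)
    (S : fo_interval_system R n) : set 'M[R]_n :=
  [set A | forall i j, A i j = lower S i j \/ A i j = upper S i j].

Definition lyap (R : realType) (n : nat) (beta : R[i]) (P : 'M[R[i]]_n)
    (A : 'M[R]_n) : 'M[R[i]]_n :=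
  let AC := map_mx (real_complex R) A in
  beta *: (P *m AC) + beta^* *: (AC^T *m P).

(* Robust stability is by definition a matrix inequality, in which the order
   of differentiation does not occur. *)
Definition robust_stable (R : realType) (n : nat) (beta : R[i])
    (S : fo_interval_system R n) : Prop :=
  forall A, interval_matrices S A ->
    exists PA : 'M[R[i]]_n, posdefmx PA /\ negdefmx (lyap beta PA A).

Section LambdaMax.
Variables (R : realType) (n : nat) (H : 'M[R[i]]_n).
Hypotheses (n_gt0 : (0 < n)%N) (Hherm : H \is hermsymmx).

Lemma herm_eigenvalue_real (z : R[i]) : eigenvalue H z -> z = ((complex.Re z)%:C)%C.
Proof.
move=> /eigenvalueP[v vH v0].
have HE : H = H ^t*.
  by move/is_hermitianmxP: Hherm; rewrite expr0 scale1r.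
have d0 : (v *m v ^t*) 0 0 != 0.
  rewrite mxE; apply/negP => /eqP/psumr_eq0P s0.
  case/eqP: v0; apply/rowP => j; rewrite [RHS]mxE.
  have := s0 _ j isT; rewrite !mxE -normCK => /(_ _)/eqP.
  rewrite expf_eq0 /= normr_eq0 => e; apply/eqP/e => i _.
  by rewrite !mxE -normCK exprn_ge0.
have e1 : v *m H *m v ^t* = z *: (v *m v ^t*) by rewrite vH scalemxAl.
have e2 : v *m H *m v ^t* = z^* *: (v *m v ^t*).
  rewrite -mulmxA {1}HE -map_mxM -trmx_mul vH linearZ /= map_mxZ.
  by rewrite -scalemxAr.
have : z = z^*.
  apply: (mulIf d0); move: e1; rewrite e2 => /matrixP/(_ 0 0).
  by rewrite mxE [in RHS]mxE.
by case: z {vH e1 e2} => a b [] /eqP; rewrite -addr_eq0 -mulr2n mulrn_eq0 /= => /eqP ->.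
Qed.

Lemma lambda_max_subproof :
  eigenvalue H ((lambda_max H)%:C)%C /\
  forall z, eigenvalue H z -> z <= ((lambda_max H)%:C)%C.
Proof.
have [r rE] := closed_field_poly_normal (char_poly H).
have eE z : eigenvalue H z = (z \in r).
  rewrite eigenvalue_root_char rE rootZ ?root_prod_XsubC //.
  by rewrite (monicP (char_poly_monic H)) oner_eq0.
have : r != [::].
  apply/eqP => r0; have := size_char_poly H; rewrite rE r0 big_nil.
  rewrite (monicP (char_poly_monic H)) scale1r size_poly1 => -[n0].
  by move: n_gt0; rewrite -n0.
have real z : z \in r -> z = ((complex.Re z)%:C)%C.
  by rewrite -eE; exact: herm_eigenvalue_real.
have maxE (s : seq R) : s != [::] ->
    exists2 m, m \in s & forall x, x \in s -> x <= m.
  elim: s => // a [|b s] IH _.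
    by exists a => [|x]; rewrite inE // => /eqP ->.
  have [//|m ms mm] := IH; move: (b :: s) ms mm => t ms mm.
  case: (leP a m) => am; [exists m | exists a]; rewrite ?inE ?eqxx ?ms ?orbT //.
  - by move=> x; rewrite inE => /predU1P[->//|/mm].
  - move=> x; rewrite inE => /predU1P[->//|/mm xm].
    exact: le_trans xm (ltW am).
move=> r0; have [|m /mapP[z zr mz] mm] := maxE [seq complex.Re z | z <- r].
  by case: (r) r0.
have mH : eigenvalue H (m%:C)%C by rewrite eE mz -real.
have um x : eigenvalue H (x%:C)%C -> x <= m.
  by rewrite eE => xr; apply: mm; apply/mapP; exists (x%:C)%C.
have -> : lambda_max H = m.
  apply/le_anti/andP; split; first by apply: ge_sup; [exists m | move=> x /um].
  by apply: ub_le_sup => //; exists m => x /um.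
split=> // w wH; have wE := herm_eigenvalue_real wH.
by rewrite wE lecR; apply: um; rewrite -wE.
Qed.

Lemma lambda_max_eigenvalue : eigenvalue H ((lambda_max H)%:C)%C.
Proof. by case: lambda_max_subproof. Qed.

Lemma lambda_max_ge z : eigenvalue H z -> z <= ((lambda_max H)%:C)%C.
Proof. by case: lambda_max_subproof => _; apply. Qed.

End LambdaMax.

(* Main.v *)
(* The given P itself serves for every A in the box. For a fixed vector v the
   form v^* (beta P A + beta^* A^T P) v is a real linear function of the entries
   of A, so over the box it is bounded by its value at a vertex, which depends
   on v. There it is negative, since by the spectral theorem a Hermitian matrix
   with negative spectrum is negative definite. *)
Require Import Defs.
From mathcomp Require Import all_boot all_order all_algebra.
From mathcomp Require Import complex.
From mathcomp Require Import classical_sets reals.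
From mathcomp Require Import ring.

Import Order.TTheory GRing.Theory Num.Theory.

Local Open Scope ring_scope.
Local Open Scope sesquilinear_scope.

(** With [U := spectralmx H] unitary and [D] diagonal, [H = U^-1 D U] gives [U H = D U], so row [i]
    of [U] is a left eigenvector. It is nonzero because [U U^* = 1] has diagonal entries 1. *)
Lemma spectral_diag_eigenvalue (C : numClosedFieldType) (n : nat) (H : 'M[C]_n)
    (i : 'I_n) :
  H \is hermsymmx -> eigenvalue H (spectral_diag H 0 i).
Proof.
move=> /hermitian_normalmx/orthomx_spectralP HE.
apply/eigenvalueP; exists (row i (spectralmx H)).
  rewrite {2}HE -!mulmxA -row_mul mulKVmx ?spectral_unit //.
  by apply/rowP => j; rewrite mul_diag_mx !mxE.
apply/eqP => r0.
have /unitarymxP/(congr1 (row i)) := spectral_unitarymx H.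
rewrite row_mul r0 mul0mx => /rowP/(_ i); rewrite !mxE eqxx => /eqP.
by rewrite eq_sym oner_eq0.
Qed.

(** In the coordinates [w = U v] of a unitary eigenbasis, the form is the sum of the [|w_i|^2]
    weighted by the eigenvalues. *)
Lemma herm_quad_lt0 (C : numClosedFieldType) (n : nat) (H : 'M[C]_n)
    (v : 'cV[C]_n) :
  H \is hermsymmx -> (forall z, eigenvalue H z -> z < 0) -> v != 0 ->
  (v ^t* *m H *m v) 0 0 < 0.
Proof.
move=> Hh eig_lt0 v0.
have /hermitian_normalmx/orthomx_spectralP HE := Hh.
pose w := spectralmx H *m v.
have w0 : w != 0.
  apply: contra v0 => /eqP w0.
  by rewrite -(mulKmx (spectral_unit H) v) -/w w0 mulmx0.
have d_lt0 i : spectral_diag H 0 i < 0.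
  exact/eig_lt0/spectral_diag_eigenvalue.
have -> : (v ^t* *m H *m v) 0 0 =
    \sum_i spectral_diag H 0 i * `|w i 0| ^+ 2.
  rewrite [X in _ *m X *m v]HE invmx_unitary ?spectral_unitarymx //.
  rewrite !mulmxA -map_mxM -trmx_mul -mulmxA -/w mul_mx_diag mxE.
  apply: eq_bigr => i _; rewrite mxE; move: (w) => u.
  by rewrite 2!mxE normCK; ring.
have [i wi0] : exists i, w i 0 != 0.
  by have /matrix0Pn[i [j]] := w0; rewrite ord1 => wi0; exists i.
have term_le0 j : spectral_diag H 0 j * `|w j 0| ^+ 2 <= 0.
  by rewrite nmulr_rle0 ?exprn_ge0.
(* Strictness comes from the one index [i] with [w i 0 != 0]. *)
rewrite (bigD1 i) //=; apply: ltr_wnDr; first by apply: sumr_le0.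
by rewrite nmulr_rlt0 // exprn_gt0 ?normr_gt0.
Qed.

(** The entries of [A] are real and [P] is Hermitian, so the adjoint of [beta P A] is
    [beta^* A^T P]. *)
Lemma lyap_adjE (R : realType) (n : nat) (beta : R[i]) (P : 'M[R[i]]_n)
    (A : 'M[R]_n) :
  let M := beta *: (P *m map_mx (real_complex R) A) in
  P \is hermsymmx -> lyap beta P A = M + M ^t*.
Proof.
move=> M /is_hermitianmxP; rewrite expr0 scale1r => PE.
congr (_ + _); rewrite /M linearZ /= map_mxZ trmx_mul map_mxM -PE.
congr (_ *: (_ *m _)); apply/matrixP => i j; rewrite !mxE.
by apply/eqP; rewrite eq_complex /= oppr0 !eqxx.
Qed.

Lemma lyap_herm {R : realType} {n : nat} (beta : R[i]) (P : 'M[R[i]]_n)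
    (A : 'M[R]_n) :
  P \is hermsymmx -> lyap beta P A \is hermsymmx.
Proof.
move=> Ph; rewrite lyap_adjE //; apply/is_hermitianmxP.
by rewrite expr0 scale1r linearD /= map_mxD trmxCK addrC.
Qed.

Definition lyap_coef {R : realType} {n : nat} (beta : R[i]) (P : 'M[R[i]]_n)
    (v : 'cV[R[i]]_n) (i j : 'I_n) : R :=
  complex.Re (beta * (v ^t* *m P) 0 i * v j 0) *+ 2.

(** The form equals [z + z^* = 2 Re z] with [z = v^* (beta P A) v]. Since [A] is real, its entries
    come out of the real part, leaving [lyap_coef]. *)
Lemma lyap_quadE (R : realType) (n : nat) (beta : R[i]) (P : 'M[R[i]]_n)
    (v : 'cV[R[i]]_n) (A : 'M[R]_n) :
  P \is hermsymmx ->
  (v ^t* *m lyap beta P A *m v) 0 0 =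
  ((\sum_i \sum_j A i j * lyap_coef beta P v i j)%:C)%C.
Proof.
move=> Ph; rewrite lyap_adjE //; set M := _ *: _.
have adjE : v ^t* *m M ^t* *m v = (v ^t* *m M *m v) ^t*.
  by rewrite !trmx_mul !map_mxM trmxCK mulmxA.
rewrite mulmxDr mulmxDl adjE mxE [X in _ + X]mxE [X in _ + X^*]mxE.
have -> : (v ^t* *m M *m v) 0 0 = \sum_i \sum_j
    (A i j)%:C%C * (beta * (v ^t* *m P) 0 i * v j 0).
  rewrite /M -scalemxAr -scalemxAl mxE mulmxA -[_ *m _ *m v]mulmxA mxE mulr_sumr.
  apply: eq_bigr => i _; rewrite [(_ *m v) i 0]mxE !mulr_sumr.
  by apply: eq_bigr => j _; rewrite !mxE; ring.
rewrite rmorph_sum /= raddf_sum -big_split; apply: eq_bigr => i _ /=.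
rewrite rmorph_sum /= raddf_sum -big_split; apply: eq_bigr => j _ /=.
rewrite /lyap_coef; case: (_ * _ * _) => a b.
apply/eqP; rewrite eq_complex /=; apply/andP; split; apply/eqP; ring.
Qed.

(** Each entry varies independently, so the sign of [c i j] alone decides which endpoint maximises
    its term. *)
Lemma vertex_dominates {R : realType} {n : nat} (S : fo_interval_system R n)
    (c : 'I_n -> 'I_n -> R) (A : 'M[R]_n) :
  interval_matrices S A ->
  exists2 V, vertex_matrices S V &
    \sum_i \sum_j A i j * c i j <= \sum_i \sum_j V i j * c i j.
Proof.
move=> AS.
exists (\matrix_(i, j) if 0 <= c i j then upper S i j else lower S i j).
  by move=> i j; rewrite mxE; case: ifP; [right | left].
apply: ler_sum => i _; apply: ler_sum => j _; rewrite mxE.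
have /andP[loA Ahi] := AS i j.
case: ifPn => [c0|]; first exact: ler_wpM2r.
by rewrite -ltNge => /ltW c0; exact: ler_wnM2r.
Qed.

Theorem theorem3p1 (R : realType) (n : nat) (n_ge1 : (1 <= n)%N)
    (alpha : R) (alpha_range : 1 <= alpha < 2) (beta : R[i])
    (lo hi : 'M[R]_n) (lo_le_hi : forall i j, lo i j <= hi i j) :
  let S := FOIntervalSystem alpha lo hi in
  (exists P : 'M[R[i]]_n, posdefmx P /\
     forall A, vertex_matrices S A -> lambda_max (lyap beta P A) < 0) ->
  robust_stable beta S.
Proof.
move=> S [P [Ppos vertex_lt0]] A AS; have Ph := Ppos.1.
exists P; split=> //; split=> [|v v0]; first exact: lyap_herm.
have [V VS AV] := vertex_dominates S (lyap_coef beta P v) A AS.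
(* The vertex [V] was chosen for this [v], which is harmless because [P] is common to all
   vertices. *)
apply: (@le_lt_trans _ _ ((v ^t* *m lyap beta P V *m v) 0 0)).
  by rewrite !lyap_quadE // lecR.
apply: herm_quad_lt0 => // [|z zE]; first exact: lyap_herm.
have zle := lambda_max_ge n_ge1 (lyap_herm _ _ V Ph) zE.
by apply: (le_lt_trans zle); rewrite ltcR; exact: vertex_lt0.
Qed.
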